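(* Consider a retailer $r\in R$ and periods $1\le k<t\le|T|$ for which $$d^r_t\sum_{l=k}^{t-1}hc^r_l\ \ge\ d^r_t\sum_{l=k}^{t-1}hc^{\delta_w(r)}_l+sc^r_t.$$ Then the variables $w^{2r}_{kt'}$ of the multi-commodity formulation $MC$ can be set to zero for every $t'\in\{t,\ldots,|T|\}$, and the guarantee of encountering an optimal solution, whenever one exists, is preserved; that is, whenever $MC$ has an optimal solution, it has an optimal solution in which $w^{2r}_{kt'}=0$ for every $t'\in\{t,\ldots,|T|\}$.
   Context: Problem data (uncapacitated three-level lot-sizing and replenishment problem with a distribution structure). $T=\{1,\ldots,|T|\}$ is a finite set of consecutive periods. $F=P\cup W\cup R$ is a finite set of facilities (disjoint union), with $P=\{p\}$ (plant), $W$ the warehouses, $R$ the retailers. Each retailer $r\in R$ has a unique predefined warehouse $\delta_w(r)\in W$. Data: fixed setup costs $sc^i_t\ge0$ and per-unit holding costs $hc^i_t\ge0$ for $i\in F$, $t\in T$; demands $d^r_t\ge0$ for $r\in R$, $t\in T$. Multi-commodity formulation $MC$. Variables: $w^{0r}_{kt},w^{1r}_{kt},w^{2r}_{kt}$ (amount produced at the plant / transported from the plant to the warehouse of $r$ / transported from that warehouse to retailer $r$ in period $k$ to satisfy $d^r_t$), $\sigma^{0r}_{kt},\sigma^{1r}_{kt},\sigma^{2r}_{kt}$ (amount held in stock at the plant / warehouse of $r$ / retailer $r$ at the end of period $k$ to satisfy $d^r_t$), for $r\in R$ and $1\le k\le t\le|T|$, and setup variables $y^i_t$ for $i\in F$,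 $t\in T$. Initial stocks are zero: $\sigma^{0r}_{0t}=\sigma^{1r}_{0t}=\sigma^{2r}_{0t}=0$. Let $\lambda_{kt}=1$ if $k=t$ and $0$ otherwise. Minimize $$\sum_{t\in T}\Big(\sum_{i\in F}sc^i_ty^i_t+\sum_{r\in R}\sum_{k\le t}hc^p_k\sigma^{0r}_{kt}+\sum_{r\in R}\sum_{k\le t}hc^{\delta_w(r)}_k\sigma^{1r}_{kt}+\sum_{r\in R}\sum_{k\le t}hc^r_k\sigma^{2r}_{kt}\Big)$$ subject to, for all $r\in R$, $k\in T$, $t\in\{k,\ldots,|T|\}$: - $\sigma^{0r}_{k-1,t}+w^{0r}_{kt}=w^{1r}_{kt}+\sigma^{0r}_{kt}$; - $\sigma^{1r}_{k-1,t}+w^{1r}_{kt}=w^{2r}_{kt}+\sigma^{1r}_{kt}$; - $\sigma^{2r}_{k-1,t}+w^{2r}_{kt}=\lambda_{kt}d^r_t+(1-\lambda_{kt})\sigma^{2r}_{kt}$; - $w^{0r}_{kt}\le d^r_ty^p_k$, $\ w^{1r}_{kt}\le d^r_ty^{\delta_w(r)}_k$, $\ w^{2r}_{kt}\le d^r_ty^r_k$; - $w^{0r}_{kt},w^{1r}_{kt},w^{2r}_{kt},\sigma^{0r}_{kt},\sigma^{1r}_{kt},\sigma^{2r}_{kt}\ge0$; and $y^i_t\in\{0,1\}$ for $i\in F$, $t\in T$.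
   Formalization: When the demand of r in period t is zero, the formal theorem also assumes that the sum of hc^r_l over l=k..t-1 is at least that of the warehouse of r; without this the claim fails (e.g. demands 0,0,1, plant setups 0,1,1, hc^p=hc^w=1, hc^r=0, k=1, t=2). *)

(* Defs.v *)
From HB Require Import structures.
From mathcomp Require Import all_boot all_order all_algebra.

Set Implicit Arguments.
Unset Strict Implicit.
Unset Printing Implicit Defensive.
Import Order.TTheory GRing.Theory Num.Theory.
Local Open Scope ring_scope.

(** Periods are the natural numbers 1, ..., nT; period-indexed data and
    variables are total functions on [nat], whose values outside the ranges of
    the model are unconstrained and do not enter the objective. Index 0 is used
    only for the initial stocks. *)

(** F = P + W + R with P = {p}. *)
Notation facility W R := (unit + (W + R))%type (only parsing).

Record lot_sizing (K : realFieldType) := LotSizing {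
  nT : nat;
  warehouse : finType;
  retailer : finType;
  dw : retailer -> warehouse;
  sc : facility warehouse retailer -> nat -> K;
  hc : facility warehouse retailer -> nat -> K;
  dem : retailer -> nat -> K;
  sc_ge0 : forall i t, (1 <= t <= nT)%N -> 0 <= sc i t;
  hc_ge0 : forall i t, (1 <= t <= nT)%N -> 0 <= hc i t;
  dem_ge0 : forall r t, (1 <= t <= nT)%N -> 0 <= dem r t
}.

Section MultiCommodity.

Variables (K : realFieldType) (D : lot_sizing K).

Definition facilities := facility (warehouse D) (retailer D).

Definition plant : facilities := inl tt.
Definition wh (r : retailer D) : facilities := inr (inl (dw r)).
Definition ret (r : retailer D) : facilities := inr (inr r).

(** [w0 x r k t] is w^{0r}_{kt}, [s0 x r k t] is sigma^{0r}_{kt}, etc. *)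
Record mc_vars := MCVars {
  w0 : retailer D -> nat -> nat -> K;
  w1 : retailer D -> nat -> nat -> K;
  w2 : retailer D -> nat -> nat -> K;
  s0 : retailer D -> nat -> nat -> K;
  s1 : retailer D -> nat -> nat -> K;
  s2 : retailer D -> nat -> nat -> K;
  y : facilities -> nat -> K
}.

Definition lambda (k t : nat) : K := if k == t then 1 else 0.

Definition mc_objective (x : mc_vars) : K :=
  \sum_(1 <= t < (nT D).+1)
    (\sum_(i : facilities) sc i t * y x i t
     + \sum_(r : retailer D) \sum_(1 <= k < t.+1) hc plant k * s0 x r k t
     + \sum_(r : retailer D) \sum_(1 <= k < t.+1) hc (wh r) k * s1 x r k t
     + \sum_(r : retailer D) \sum_(1 <= k < t.+1) hc (ret r) k * s2 x r k t).

Definition mc_initial (x : mc_vars) : Prop :=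
  forall r t, (1 <= t <= nT D)%N ->
    [/\ s0 x r 0 t = 0, s1 x r 0 t = 0 & s2 x r 0 t = 0].

Definition mc_balance (x : mc_vars) (r : retailer D) (k t : nat) : Prop :=
  [/\ s0 x r k.-1 t + w0 x r k t = w1 x r k t + s0 x r k t,
      s1 x r k.-1 t + w1 x r k t = w2 x r k t + s1 x r k t
    & s2 x r k.-1 t + w2 x r k t
      = lambda k t * dem r t + (1 - lambda k t) * s2 x r k t].

Definition mc_setup (x : mc_vars) (r : retailer D) (k t : nat) : Prop :=
  [/\ w0 x r k t <= dem r t * y x plant k,
      w1 x r k t <= dem r t * y x (wh r) k
    & w2 x r k t <= dem r t * y x (ret r) k].

Definition mc_nonneg (x : mc_vars) (r : retailer D) (k t : nat) : Prop :=
  [/\ 0 <= w0 x r k t, 0 <= w1 x r k t & 0 <= w2 x r k t]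
  /\ [/\ 0 <= s0 x r k t, 0 <= s1 x r k t & 0 <= s2 x r k t].

Definition mc_binary (x : mc_vars) : Prop :=
  forall i t, (1 <= t <= nT D)%N -> y x i t = 0 \/ y x i t = 1.

Definition mc_feasible (x : mc_vars) : Prop :=
  [/\ mc_initial x,
      forall r k t, (1 <= k)%N -> (k <= t)%N -> (t <= nT D)%N ->
        [/\ mc_balance x r k t, mc_setup x r k t & mc_nonneg x r k t]
    & mc_binary x].

Definition mc_optimal (x : mc_vars) : Prop :=
  mc_feasible x
  /\ forall x', mc_feasible x' -> mc_objective x <= mc_objective x'.

End MultiCommodity.

Arguments plant {K D}.

(* Main.v *)
Require Import Defs.
From HB Require Import structures.
From mathcomp Require Import all_boot all_order all_algebra.
From mathcomp Require Import zify ring lra.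
Set Implicit Arguments.
Unset Strict Implicit.
Unset Printing Implicit Defensive.
Import Order.TTheory GRing.Theory Num.Theory.
Local Open Scope ring_scope.

(** For fixed setups, serving one demand [d^r_t] is a min-cost flow from the
    plant to the retailer, so by weak duality it costs at least [d^r_t] times
    the unit cost of some path that uses open setups only. Hence every commodity
    of [r] may be rerouted along one such path. If period [t] is open at [r], or
    can be opened at no net cost, every path delivering in period [k] is delayed
    to [t], which by hypothesis does not increase the unit cost. Opening [t] is
    paid for as soon as some cheapest path for [d^r_t] delivers in [k].
    Otherwise [t] is closed and a cheapest path for [d^r_t] avoids [k] and
    delivers before [t], so each later commodity delivered in [k] can follow it
    instead: the unit cost of a path to a later period differs from that to [t]
    only by the holding cost at [r] from [t] on. *)

(** * Node potentials for the flow through one level *)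

Section FlowPotential.

Variables (K : realFieldType) (n : nat) (h u win wout s : nat -> K).
Hypothesis s0E : s 0 = 0.
Hypothesis h_ge0 : forall k, (1 <= k <= n)%N -> 0 <= h k.
Hypothesis u_ge0 : forall k, (1 <= k <= n)%N -> 0 < win k -> 0 <= u k.
Hypothesis win_ge0 : forall k, (1 <= k <= n)%N -> 0 <= win k.
Hypothesis wout_ge0 : forall k, (1 <= k <= n)%N -> 0 <= wout k.
Hypothesis s_ge0 : forall k, (1 <= k <= n)%N -> 0 <= s k.
Hypothesis balance : forall k, (1 <= k <= n)%N ->
  s k.-1 + win k = wout k + s k.

(* The cheapest unit cost of being available in period [k], over the arcs that
   carry flow; a junk value when no flow is available in period [k]. *)
Fixpoint potential (k : nat) : K :=
  if k is k'.+1 then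
    if win k == 0 then potential k' + h k'
    else if s k' == 0 then u k
    else Num.min (potential k' + h k') (u k)
  else 0.

Let s_ge0' k : (k <= n)%N -> 0 <= s k.
Proof. by case: k => [|k] kn; [rewrite s0E | apply: s_ge0]. Qed.

(** Since flow is available in period [k], each branch of the recursion follows an arc that carries
    flow; unwinding it ends at a period with inflow. *)
Lemma potential_source k : (1 <= k <= n)%N -> 0 < s k.-1 + win k ->
  exists j, [/\ (1 <= j <= k)%N, 0 < win j
              & potential k = u j + \sum_(j <= l < k) h l].
Proof.
elim: k => // k IHk kn.
have pre : 0 < s k -> exists j, [/\ (1 <= j <= k.+1)%N, 0 < win j
    & potential k + h k = u j + \sum_(j <= l < k.+1) h l].
  case: (posnP k) => [-> | k_gt0]; first by rewrite s0E ltxx.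
  have kn' : (1 <= k <= n)%N by lia.
  move=> sk; have [|j [jk wj ->]] := IHk kn'.
    by rewrite balance // ltr_wpDl // wout_ge0.
  exists j; split=> //; first by lia.
  by rewrite big_nat_recr /= ?addrA //; case/andP: jk.
have new : 0 < win k.+1 -> exists j, [/\ (1 <= j <= k.+1)%N, 0 < win j
    & u k.+1 = u j + \sum_(j <= l < k.+1) h l].
  by move=> w; exists k.+1; split; rewrite ?leqnn // big_geq // addr0.
have sk_ge0 : 0 <= s k by apply: s_ge0'; lia.
rewrite /=; case: eqVneq => [-> | w_neq0 _].
  by rewrite addr0; apply: pre.
have w_gt0 : 0 < win k.+1 by rewrite lt_def w_neq0 win_ge0.
case: eqVneq => [_ | s_neq0]; first exact: new.
by rewrite minElt; case: ifP => _; [apply: pre; rewrite lt_def s_neq0 | apply: new].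
Qed.

Lemma potential_ge0 k : (1 <= k <= n)%N -> 0 < s k.-1 + win k ->
  0 <= potential k.
Proof.
move=> kn /(potential_source kn)[j [jk wj ->]].
apply: addr_ge0; first by apply: u_ge0 => //; lia.
by rewrite big_nat; apply: sumr_ge0 => l lk; apply: h_ge0; lia.
Qed.

(** Weak duality by induction on [m]: a potential is at most the price along each incoming arc that
    carries flow. Stock left after [m] is priced at its entry into the next period, holding cost
    included. *)
Lemma potential_cost_stock m : (m <= n)%N ->
  \sum_(1 <= k < m.+1) potential k * wout k + (potential m + h m) * s m
  <= \sum_(1 <= k < m.+1) (u k * win k + h k * s k).
Proof.
elim: m => [_|m IHm mn]; first by rewrite !big_geq // s0E mulr0 addr0.
have mn' : (m <= n)%N by lia.
rewrite big_nat_recr //= [leRHS]big_nat_recr //=.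
have step : potential m.+1 * (s m + win m.+1)
    <= (potential m + h m) * s m + u m.+1 * win m.+1.
  have s_nneg := s_ge0' mn'.
  have w_nneg : 0 <= win m.+1 by apply: win_ge0; lia.
  rewrite [potential m.+1]/=; case: eqVneq => [->|_]; first by lra.
  case: eqVneq => [->|_]; first by lra.
  rewrite mulrDr; apply: lerD; apply: ler_wpM2r => //.
    by rewrite ge_min lexx.
  by rewrite ge_min lexx orbT.
have := IHm mn'.
have := @balance m.+1 mn; rewrite [m.+1.-1]/= => bal.
move: step; rewrite bal -[if _ then _ else _]/(potential m.+1).
rewrite !mulrDl mulrDr; lra.
Qed.

Lemma potential_cost :
  \sum_(1 <= k < n.+1) potential k * wout k
  <= \sum_(1 <= k < n.+1) (u k * win k + h k * s k).
Proof.
(* The final stock need not vanish; if it is positive, flow is available in period [n], so its price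
   is nonnegative. *)
apply: le_trans (potential_cost_stock (leqnn n)); rewrite lerDl.
have [->|sn_neq0] := eqVneq (s n) 0; first by rewrite mulr0.
have n_gt0 : (0 < n)%N by case: (posnP n) sn_neq0 => // ->; rewrite s0E eqxx.
have nn : (1 <= n <= n)%N by lia.
have sn_gt0 : 0 < s n by rewrite lt_def sn_neq0 s_ge0.
apply: mulr_ge0; last exact: ltW.
apply: addr_ge0; last exact: h_ge0.
by apply: potential_ge0 => //; rewrite balance // ltr_wpDl // wout_ge0.
Qed.

End FlowPotential.

(** Levels can be stacked: [pi], nonnegative where [wout] is positive, is a valid inflow price [u]
    for the next level, whose inflow is this [wout]. *)
Lemma one_level_potential (K : realFieldType) (n : nat)
    (h u win wout s : nat -> K) :
  s 0 = 0 ->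
  (forall k, (1 <= k <= n)%N -> 0 <= h k) ->
  (forall k, (1 <= k <= n)%N -> 0 < win k -> 0 <= u k) ->
  (forall k, (1 <= k <= n)%N -> [/\ 0 <= win k, 0 <= wout k & 0 <= s k]) ->
  (forall k, (1 <= k <= n)%N -> s k.-1 + win k = wout k + s k) ->
  exists pi : nat -> K,
    [/\ \sum_(1 <= k < n.+1) pi k * wout k
        <= \sum_(1 <= k < n.+1) (u k * win k + h k * s k),
        forall k, (1 <= k <= n)%N -> 0 < wout k -> 0 <= pi k
      & forall k, (1 <= k <= n)%N -> 0 < wout k ->
        exists j, [/\ (1 <= j <= k)%N, 0 < win j
                    & pi k = u j + \sum_(j <= l < k) h l]].
Proof.
move=> s0E h_ge0 u_ge0 nneg balance.
have in_ge0 k : (1 <= k <= n)%N -> 0 <= win k by case/nneg.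
have out_ge0 k : (1 <= k <= n)%N -> 0 <= wout k by case/nneg.
have s_ge0 k : (1 <= k <= n)%N -> 0 <= s k by case/nneg.
have avail k : (1 <= k <= n)%N -> 0 < wout k -> 0 < s k.-1 + win k.
  by move=> kn wk; rewrite balance // ltr_wpDr // s_ge0.
exists (potential h u win s); split.
- exact: potential_cost.
- by move=> k kn /(avail _ kn); apply: (@potential_ge0 _ n _ _ _ wout).
- by move=> k kn /(avail _ kn); apply: (@potential_source _ n _ _ _ wout).
Qed.

Lemma sum_nat_indic (K : realFieldType) (F : nat -> K) (d : K) (a b n : nat) :
  (1 <= a)%N -> (b <= n)%N ->
  \sum_(1 <= k < n) F k * (d * (a <= k < b)%N%:R) = d * \sum_(a <= k < b) F k.
Proof.
move=> a_gt0 bn; rewrite (big_nat_widen _ _ _ _ _ bn) (big_nat_widenl _ _ _ _ _ a_gt0).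
rewrite big_mkcond mulr_sumr; apply: eq_bigr => k _ /=.
by rewrite andbC; case: ifP => _; rewrite ?mulr1 ?mulr0 1?mulrC.
Qed.

(** * Open paths and their unit costs *)

Section Paths.

Variables (K : realFieldType) (D : lot_sizing K).
Implicit Types (x : mc_vars D) (r : retailer D).

Definition commodity_cost x r t : K :=
  \sum_(1 <= k < t.+1) (hc (@plant _ D) k * s0 x r k t + hc (wh r) k * s1 x r k t
                        + hc (ret r) k * s2 x r k t).

Lemma mc_objectiveE x :
  mc_objective x = \sum_(1 <= t < (nT D).+1)
    (\sum_(i : facilities D) sc i t * y x i t
     + \sum_(r : retailer D) commodity_cost x r t).
Proof.
apply: eq_bigr => t _; rewrite -!addrA -!big_split /=; congr (_ + _).
by apply: eq_bigr => r _; rewrite -!big_split /=; apply: eq_bigr => k _; rewrite addrA.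
Qed.

(* A path [(a, b, c)] produces in period [a], ships to the warehouse in period
   [b] and to the retailer in period [c]. *)
Definition unit_cost r (p : nat * nat * nat) t : K :=
  let: (a, b, c) := p in
  \sum_(a <= l < b) hc (@plant _ D) l + \sum_(b <= l < c) hc (wh r) l
  + \sum_(c <= l < t) hc (ret r) l.

Arguments unit_cost : simpl never.

Definition open_path (z : facilities D -> nat -> K) r (p : nat * nat * nat) t :=
  let: (a, b, c) := p in
  [&& (1 <= a)%N, (a <= b)%N, (b <= c)%N, (c <= t)%N,
      z plant a == 1, z (wh r) b == 1 & z (ret r) c == 1].

(** The potentials of plant, warehouse and retailer are chained, each pricing the inflow of the
    next. The path is traced back from [t] through periods of positive flow, whose setups must be
    open. *)
Lemma cheap_path x r t : mc_feasible x -> (1 <= t <= nT D)%N -> 0 < dem r t ->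
  exists2 p, open_path (y x) r p t
           & dem r t * unit_cost r p t <= commodity_cost x r t.
Proof.
case=> init feas bin tT d_gt0; have [s00 s10 s20] := init r t tT.
have kT k : (1 <= k <= t)%N -> [/\ (1 <= k)%N, (k <= t)%N & (t <= nT D)%N].
  by move=> kt; split; lia.
have fk k : (1 <= k <= t)%N ->
    [/\ mc_balance x r k t, mc_setup x r k t & mc_nonneg x r k t].
  by case/kT => *; apply: feas.
have h_ge0 i k : (1 <= k <= t)%N -> 0 <= (@hc _ D i k).
  by move=> kt; apply: hc_ge0; lia.
have open i k w : (1 <= k <= t)%N -> 0 < w -> w <= dem r t * y x i k ->
    y x i k = 1.
  move=> kt w_gt0 wle; case: (bin i k) => //; first by lia.
  by move=> y0; move: wle; rewrite y0; lra.
have [||||k kt|pi0 [cost0 pi0_ge0 src0]] := @one_level_potential K t (hc (@plant _ D))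
    (fun=> 0) (w0 x r ^~ t) (w1 x r ^~ t) (s0 x r ^~ t) => //.
- exact: h_ge0.
- by move=> k /fk[_ _ [[? ? ?] [? ? ?]]].
- by case/fk: kt => -[].
have [||||k kt|pi1 [cost1 pi1_ge0 src1]] := @one_level_potential K t
    (hc (wh r)) pi0 (w1 x r ^~ t) (w2 x r ^~ t) (s1 x r ^~ t) => //.
- exact: h_ge0.
- by move=> k /fk[_ _ [[? ? ?] [? ? ?]]].
- by case/fk: kt => -[].
have lam01 k : 0 <= lambda K k t /\ 0 <= 1 - lambda K k t.
  by rewrite /lambda; case: ifP => _; split; rewrite ?subrr ?subr0.
(* The outflow is the demand, all in period [t]; the factor [1 - lambda] discards the stock at
   [k = t], which does not enter the balance. *)
have [||||k kt|pi2 [cost2 _ src2]] := @one_level_potential K t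
    (hc (ret r)) pi1 (w2 x r ^~ t) (fun k => lambda K k t * dem r t)
    (fun k => (1 - lambda K k t) * s2 x r k t) => //.
- by rewrite s20 mulr0.
- exact: h_ge0.
- move=> k /fk[_ _ [[_ _ ?] [_ _ ?]]]; have [? ?] := lam01 k.
  by split=> //; apply: mulr_ge0 => //; apply: ltW.
- case/fk: (kt) => -[_ _ <-] _ _; congr (_ + _).
  by rewrite /lambda ifN ?subr0 ?mul1r //; lia.
have tt : (1 <= t <= t)%N by lia.
have lamt : lambda K t t = 1 by rewrite /lambda eqxx.
have [|c [ct w2c pi2E]] := src2 t tt; first by rewrite lamt mul1r.
have ct' : (1 <= c <= t)%N by [].
have [b [bc w1b pi1E]] := src1 c ct' w2c.
have bt : (1 <= b <= t)%N by lia.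
have [a [ab w0a pi0E]] := src0 b bt w1b.
have at' : (1 <= a <= t)%N by clear -ab bt; lia.
exists (a, b, c).
  have [_ [open_a _ _] _] := fk a at'.
  have [_ [_ open_b _] _] := fk b bt.
  have [_ [_ _ open_c] _] := fk c ct'.
  rewrite /= (open _ _ _ at' w0a open_a) (open _ _ _ bt w1b open_b).
  rewrite (open _ _ _ ct' w2c open_c) eqxx !andbT.
  by case/andP: ab bc ct => -> -> /andP[_ ->] /andP[_ ->].
have -> : unit_cost r (a, b, c) t = pi2 t.
  by rewrite pi2E pi1E pi0E add0r.
have -> : dem r t * pi2 t = \sum_(1 <= k < t.+1) pi2 k * (lambda K k t * dem r t).
  rewrite big_nat_recr /=; last by case/andP: tT.
  rewrite lamt mul1r mulrC big1_seq ?add0r // => k.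
  rewrite mem_index_iota => /andP[_ /andP[_ kt]].
  by rewrite /lambda ltn_eqF // mul0r mulr0.
apply: le_trans cost2 _; rewrite /commodity_cost !big_split /=.
apply: lerD.
  apply: le_trans cost1 _; rewrite big_split /= lerD2r.
  apply: le_trans cost0 _.
  by rewrite le_eqVlt; apply/orP; left; apply/eqP/eq_bigr => k _; rewrite mul0r add0r.
rewrite !big_nat; apply: ler_sum => k kt.
have kt' : (1 <= k <= t)%N by rewrite -ltnS.
have [_ _ [_ [_ _ s2_ge0]]] := fk k kt'.
apply: ler_wpM2l; first exact: h_ge0.
by have [l_ge0 _] := lam01 k; rewrite ler_piMl // gerBl.
Qed.

(** * Rerouting the commodities of one retailer *)

Definition set_setup (z : facilities D -> nat -> K) r t v :
    facilities D -> nat -> K :=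
  fun i l => if (i == ret r) && (l == t) then v else z i l.

(** Stock intervals are half-open because stock is counted at the end of a period. *)
Definition reroute x r (p : nat -> nat * nat * nat) t v : mc_vars D :=
  let on (P : nat * nat * nat -> nat -> nat -> bool) old r' k t' : K :=
    if r' == r then dem r t' * (P (p t') k t')%:R else old r' k t' in
  MCVars
    (on (fun q k _ => k == q.1.1) (w0 x))
    (on (fun q k _ => k == q.1.2) (w1 x))
    (on (fun q k _ => k == q.2) (w2 x))
    (on (fun q k _ => (q.1.1 <= k < q.1.2)%N) (s0 x))
    (on (fun q k _ => (q.1.2 <= k < q.2)%N) (s1 x))
    (on (fun q k t' => (q.2 <= k < t')%N) (s2 x))
    (set_setup (y x) r t v).

Section Reroute.

Variables (x : mc_vars D) (r : retailer D) (p : nat -> nat * nat * nat).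
Variables (t : nat) (v : K).
Hypothesis feas : mc_feasible x.
Hypothesis v01 : v = 0 \/ v = 1.
Hypothesis v_ge : y x (ret r) t <= v.
Hypothesis p_open : forall t', (1 <= t' <= nT D)%N -> 0 < dem r t' ->
  open_path (set_setup (y x) r t v) r (p t') t'.

Lemma reroute_feasible : mc_feasible (reroute x r p t v).
Proof.
have [init fk bin] := feas.
split.
- move=> r' t' t'T /=; have [i0 i1 i2] := init r' t' t'T.
  case: eqP => [_|//].
  (* At zero demand the path is arbitrary, but all its quantities are multiplied by zero. *)
  have := dem_ge0 r t'T; rewrite le_eqVlt => /orP[/eqP<-|/(p_open t'T)].
    by rewrite !mul0r.
  case: (p t') => [[a b] c] /= /and5P[a1 ab bc _ _].
  have -> : (a <= 0)%N = false by lia.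
  have -> : (b <= 0)%N = false by lia.
  have -> : (c <= 0)%N = false by lia.
  by rewrite !mulr0.
- move=> r' k t' k1 kt' t'T; have [bal [le0 le1 le2] nneg] := fk r' k t' k1 kt' t'T.
  rewrite /mc_balance /mc_setup /mc_nonneg /=; case: (eqVneq r' r) => [-> | r'r].
    have t'T' : (1 <= t' <= nT D)%N by lia.
    have d_ge0 := dem_ge0 r t'T'.
    split; last by split; split; rewrite mulr_ge0 // ler0n.
      have [->|d_neq0] := eqVneq (dem r t') 0.
        by rewrite !mul0r !mulr0 !addr0.
      have d_gt0 : 0 < dem r t' by rewrite lt_def d_neq0.
      move: (p_open t'T' d_gt0); case: (p t') => [[a b] c] /=.
      case/and5P=> a1 ab bc ct' _.
      (* With the demand factored out, each balance relates indicators of [k]. *)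
      split; [| | rewrite /lambda]; rewrite -!mulrDr -!natrD.
      - by congr (_ * _%:R); lia.
      - by congr (_ * _%:R); lia.
      - case: (eqVneq k t') => [kt'E|kt'E].
          rewrite subrr mul0r addr0 mul1r (_ : (_ + _)%N = 1%N) ?mulr1 //.
          by lia.
        by rewrite subr0 mul0r add0r mul1r; congr (_ * _%:R); lia.
    have [->|d_neq0] := eqVneq (dem r t') 0; first by rewrite !mul0r.
    have d_gt0 : 0 < dem r t' by rewrite lt_def d_neq0.
    move: (p_open t'T' d_gt0); case: (p t') => [[a b] c] /=.
    case/and5P=> a1 ab bc ct' /and3P[/eqP ya /eqP yb /eqP yc].
    have y_ge0 i : 0 <= set_setup (y x) r t v i k.
      rewrite /set_setup; case: ifP => _; first by case: v01 => ->.
      by case: (bin i k) => [|->|->] //; lia.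
    by split; apply: ler_wpM2l => //; case: eqP => // ->; rewrite ?ya ?yb ?yc.
  split=> //; split.
  + by rewrite /set_setup.
  + by rewrite /set_setup.
  + rewrite /set_setup ifN //; apply/negP => /andP[/eqP[/eqP]].
    by rewrite (negPf r'r).
- move=> i l lT; rewrite /= /set_setup; case: ifP => // _; exact: bin.
Qed.

Lemma commodity_cost_reroute t' : (1 <= t' <= nT D)%N ->
  commodity_cost (reroute x r p t v) r t' = dem r t' * unit_cost r (p t') t'.
Proof.
move=> t'T; rewrite /commodity_cost /= eqxx.
have := dem_ge0 r t'T; rewrite le_eqVlt => /orP[/eqP<-|/(p_open t'T)].
  by rewrite mul0r big1 // => k _; rewrite !mul0r !mulr0 !addr0.
case: (p t') => [[a b] c] /= /and5P[a1 ab bc ct' _].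
by rewrite /unit_cost !big_split /= !sum_nat_indic ?mulrDr //; lia.
Qed.

(** The comparison is made period by period; the setup changes only in period [t], so its cost is
    charged to commodity [t]. *)
Lemma reroute_objective :
  (forall t', (1 <= t' <= nT D)%N ->
     dem r t' * unit_cost r (p t') t'
       + (t' == t)%:R * (sc (ret r) t * (v - y x (ret r) t))
     <= commodity_cost x r t') ->
  mc_objective (reroute x r p t v) <= mc_objective x.
Proof.
move=> cheaper; rewrite !mc_objectiveE !big_nat; apply: ler_sum => t' t'T.
have {}t'T : (1 <= t' <= nT D)%N by lia.
rewrite (bigD1 (ret r)) //= [\sum_(r' : retailer D) _](bigD1 r) //=.
rewrite commodity_cost_reroute //.
rewrite [X in _ <= X + _](bigD1 (ret r)) //= [X in _ <= _ + X](bigD1 r) //=.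
have -> : \sum_(i | i != ret r) sc i t' * set_setup (y x) r t v i t'
          = \sum_(i | i != ret r) sc i t' * y x i t'.
  by apply: eq_bigr => i ir; rewrite /set_setup (negPf ir).
have -> : \sum_(i | i != r) commodity_cost (reroute x r p t v) i t'
          = \sum_(i | i != r) commodity_cost x i t'.
  by apply: eq_bigr => i ir; rewrite /commodity_cost /= (negPf ir).
have := cheaper t' t'T; rewrite /set_setup eqxx /=.
by case: eqP => [->|_]; rewrite ?mul1r ?mul0r; lra.
Qed.

End Reroute.

(** Paths are chosen separately for each commodity; [good] is boolean so that [xchoose] can gather
    them into one function. *)
Lemma reroute_optimal x r t v k :
  mc_optimal x -> v = 0 \/ v = 1 -> y x (ret r) t <= v ->
  let good p t' :=
    [&& (0 < dem r t') ==> open_path (set_setup (y x) r t v) r p t',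
        dem r t' * unit_cost r p t'
          + (t' == t)%:R * (sc (ret r) t * (v - y x (ret r) t))
        <= commodity_cost x r t'
      & ((0 < dem r t') && (t <= t')%N) ==> (p.2 != k)] in
  (forall t', (1 <= t' <= nT D)%N -> exists p, good p t') ->
  exists x' : mc_vars D, mc_optimal x'
    /\ forall t', (t <= t')%N -> (1 <= t' <= nT D)%N -> w2 x' r k t' = 0.
Proof.
move=> [feas opt] v01 v_ge good paths.
have {}paths t' : exists p, (1 <= t' <= nT D)%N ==> good p t'.
  case: (boolP (1 <= t' <= nT D)%N) => [/paths//|_]; by exists (0, 0, 0)%N.
have [p pP] : exists p, forall t', (1 <= t' <= nT D)%N -> good (p t') t'.
  by exists (fun t' => xchoose (paths t')) => t'; apply/implyP/(xchooseP (paths t')).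
have p_open t' : (1 <= t' <= nT D)%N -> 0 < dem r t' ->
    open_path (set_setup (y x) r t v) r (p t') t'.
  by move=> /pP/and3P[/implyP].
exists (reroute x r p t v); split.
  split; first exact: reroute_feasible.
  move=> x' /opt; apply: le_trans; apply: reroute_objective => // t' /pP.
  by case/and3P.
move=> t' tt' t'T /=; rewrite eqxx.
have := dem_ge0 r t'T; rewrite le_eqVlt => /orP[/eqP<-|d_gt0].
  by rewrite mul0r.
have /and3P[_ _] := pP t' t'T; rewrite d_gt0 tt' /= eq_sym => /negPf->.
by rewrite mulr0.
Qed.

(** * Delaying and extending paths *)

Lemma unit_cost_shift r a b k t t' : (b <= k)%N -> (k <= t)%N -> (t <= t')%N ->
  unit_cost r (a, b, t) t' + \sum_(k <= l < t) hc (ret r) l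
  = unit_cost r (a, b, k) t' + \sum_(k <= l < t) hc (wh r) l.
Proof.
move=> bk kt tt'; rewrite /unit_cost /=.
rewrite (big_cat_nat bk kt) (big_cat_nat kt tt') /=; ring.
Qed.

(** Hence two paths delivering by [t] compare alike for every later commodity. *)
Lemma unit_cost_tail r p t t' : (p.2 <= t)%N -> (t <= t')%N ->
  unit_cost r p t' = unit_cost r p t + \sum_(t <= l < t') hc (ret r) l.
Proof.
by case: p => [[a b] c] /= ct tt'; rewrite /unit_cost /= (big_cat_nat ct tt') /= !addrA.
Qed.

Lemma open_path_shift z r a b k t t' : (k <= t)%N -> (t <= t')%N ->
  open_path z r (a, b, k) t' ->
  open_path (set_setup z r t 1) r (a, b, t) t'.
Proof.
move=> kt tt' /= /and5P[-> -> bk _ /and3P[/eqP za /eqP zb _]].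
by rewrite (leq_trans bk kt) tt' /set_setup !eqxx /= za zb eqxx.
Qed.

Lemma open_path_set_setup z r p t t' :
  open_path z r p t' -> open_path (set_setup z r t 1) r p t'.
Proof.
case: p => [[a b] c] /= /and5P[-> -> -> -> /and3P[za zb zc]].
by rewrite /set_setup /= za zb; case: ifP => // _; rewrite eqxx.
Qed.

Lemma open_path_tail z r p t t' : (t <= t')%N ->
  open_path z r p t -> open_path z r p t'.
Proof.
case: p => [[a b] c] tt' /= /and5P[-> -> -> ct ->].
by rewrite (leq_trans ct tt').
Qed.

Lemma open_path_le z r p t : open_path z r p t -> (p.2 <= t)%N.
Proof. by case: p => [[a b] c] /and5P[]. Qed.

Lemma commodity_cost_ge0 x r t : mc_feasible x -> (1 <= t <= nT D)%N ->
  0 <= commodity_cost x r t.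
Proof.
case=> _ feas _ tT; rewrite /commodity_cost big_nat; apply: sumr_ge0 => k kt.
have kT : (1 <= k <= nT D)%N by lia.
have [|||_ _ [_ [? ? ?]]] := feas r k t; [by lia | by lia | by lia |].
by rewrite !addr_ge0 // mulr_ge0 // hc_ge0.
Qed.

(* If period [t] is open at the retailer then every path delivering in period
   [k] can be delayed to [t]; only commodity [t] has to pay for opening it. *)
Lemma open_and_delay x r k t : (1 <= t <= nT D)%N -> (k < t)%N ->
  mc_optimal x ->
  \sum_(k <= l < t) hc (wh r) l <= \sum_(k <= l < t) hc (ret r) l ->
  (exists p,
    [&& (0 < dem r t) ==> open_path (set_setup (y x) r t 1) r p t,
        dem r t * unit_cost r p t + sc (ret r) t * (1 - y x (ret r) t)
        <= commodity_cost x r t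
      & (0 < dem r t) ==> (p.2 != k)]) ->
  exists x' : mc_vars D, mc_optimal x'
    /\ forall t', (t <= t')%N -> (1 <= t' <= nT D)%N -> w2 x' r k t' = 0.
Proof.
move=> tT kt opt hle [pt pt_ok].
have [feas _] := opt; have [_ _ bin] := feas.
apply: (reroute_optimal (v := 1) opt); first by right.
  by case: (bin (ret r) t tT) => ->; rewrite ?ler01.
move=> t' t'T; have [t'E | t't] := eqVneq t' t.
  by exists pt; rewrite t'E leqnn andbT mul1r.
have := dem_ge0 r t'T; rewrite le_eqVlt => /orP[/eqP<-|d_gt0].
  exists (0, 0, 0)%N; rewrite ltxx !mul0r addr0 /=.
  by rewrite commodity_cost_ge0.
have [p p_open p_cost] := cheap_path feas t'T d_gt0.
rewrite d_gt0.
case: (boolP ((t <= t')%N && (p.2 == k))) => [/andP[tt' /eqP pk] | p_ok].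
  case: p pk p_open p_cost => [[a b] c] /= -> p_open p_cost.
  exists (a, b, t); rewrite (open_path_shift (ltnW kt) tt' p_open) //= tt' gtn_eqF // andbT.
  rewrite mul0r addr0; apply: le_trans p_cost; rewrite ler_wpM2l ?(ltW d_gt0) //.
  have bk : (b <= k)%N by case/and5P: p_open.
  by have := unit_cost_shift r a bk (ltnW kt) tt'; lra.
exists p; rewrite open_path_set_setup //= mul0r addr0 p_cost /=.
by apply/implyP => tt'; move: p_ok; rewrite tt'.
Qed.

End Paths.

Theorem proposition12 (K : realFieldType) (D : lot_sizing K)
    (r : retailer D) (k t : nat)
    (hk : (1 <= k)%N) (hkt : (k < t)%N) (ht : (t <= nT D)%N)
    (hcost : dem r t * (\sum_(k <= l < t) hc (ret r) l)
             >= dem r t * (\sum_(k <= l < t) hc (wh r) l) + sc (ret r) t)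
    (hzero : dem r t = 0 ->
             \sum_(k <= l < t) hc (ret r) l >= \sum_(k <= l < t) hc (wh r) l) :
  (exists x : mc_vars D, mc_optimal x) ->
  exists x : mc_vars D,
    mc_optimal x
    /\ forall t' : nat, (t <= t')%N -> (t' <= nT D)%N -> w2 x r k t' = 0.
Proof.
move=> [x opt]; have [feas _] := opt; have [_ _ bin] := feas.
have tT : (1 <= t <= nT D)%N by lia.
suff [x' [opt' zero]] : exists x' : mc_vars D, mc_optimal x'
    /\ forall t', (t <= t')%N -> (1 <= t' <= nT D)%N -> w2 x' r k t' = 0.
  exists x'; split=> // t' tt' t'T; apply: zero => //.
  by rewrite t'T andbT; case/andP: tT => ? _; apply: leq_trans tt'.
have sc_nneg := sc_ge0 (ret r) tT.
have := dem_ge0 r tT; rewrite le_eqVlt => /orP[/eqP d0|d_gt0].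
  (* Here [hcost] forces a zero setup cost, so opening [t] is free; the path is a dummy. *)
  apply: (open_and_delay tT hkt opt); first exact: hzero.
  exists (0, 0, 0)%N; rewrite -d0 ltxx mul0r add0r andbT /=.
  have -> : sc (ret r) t = 0 by move: hcost; rewrite -d0 !mul0r; lra.
  by rewrite mul0r commodity_cost_ge0.
have hle : \sum_(k <= l < t) hc (wh r) l <= \sum_(k <= l < t) hc (ret r) l.
  by rewrite -(ler_pM2l d_gt0); lra.
have [p p_open p_cost] := cheap_path feas tT d_gt0.
(* A path for [t] through [k] no dearer than [p] can be delayed to [t], and the
   saving pays for opening period [t]. *)
have delay a b : open_path (y x) r (a, b, k) t ->
    unit_cost r (a, b, k) t <= unit_cost r p t ->
    exists x' : mc_vars D, mc_optimal x'
    /\ forall t', (t <= t')%N -> (1 <= t' <= nT D)%N -> w2 x' r k t' = 0.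
  move=> q_open q_le; apply: (open_and_delay tT hkt opt hle).
  exists (a, b, t); rewrite d_gt0 (open_path_shift (ltnW hkt) (leqnn t) q_open) //= gtn_eqF // andbT.
  apply: le_trans p_cost.
  have bk : (b <= k)%N by case/and5P: q_open.
  have qE := unit_cost_shift r a bk (ltnW hkt) (leqnn t).
  have sc_le : sc (ret r) t * (1 - y x (ret r) t) <= sc (ret r) t.
    by case: (bin (ret r) t tT) => ->; lra.
  have := ler_wpM2l (ltW d_gt0) q_le.
  have := congr1 (fun c => dem r t * c) qE; rewrite !mulrDr; lra.
(* If [t] is already open, [p] is kept when it avoids [k] and delayed otherwise. *)
case: (bin (ret r) t tT) => [yt|yt]; last first.
  have [pk | pk] := eqVneq p.2 k.
    by case: p pk p_open p_cost delay => [[a b] c] /= -> p_open _ delay; exact: delay p_open (lexx _).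
  apply: (open_and_delay tT hkt opt hle).
  by exists p; rewrite yt subrr mulr0 addr0 open_path_set_setup ?pk ?p_cost ?implybT.
(* Bounding both entries by [t] loses no open path and makes the search decidable. *)
have [/existsP[a /existsP[b /andP[]]] | none] := boolP [exists a : 'I_t.+1,
    [exists b : 'I_t.+1, open_path (y x) r (nat_of_ord a, nat_of_ord b, k) t
       && (unit_cost r (nat_of_ord a, nat_of_ord b, k) t <= unit_cost r p t)]].
  exact: delay.
have {}none a b : open_path (y x) r (a, b, k) t ->
    unit_cost r p t < unit_cost r (a, b, k) t.
  move=> q_open; rewrite ltNge; apply: contra none => q_le.
  have [at1 bt1] : (a < t.+1)%N /\ (b < t.+1)%N.
    by move: q_open => /and5P[_ ? ? ? _]; lia.
  by apply/existsP; exists (Ordinal at1); apply/existsP; exists (Ordinal bt1); apply/andP.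
(* Otherwise [none] would make [p] strictly cheaper than itself. *)
have pk : p.2 != k.
  apply/eqP => pk; case: p pk p_open none {p_cost delay} => [[a b] c] /= -> p_open none.
  by have := none _ _ p_open; rewrite ltxx.
have setupE : set_setup (y x) r t 0 =2 y x.
  by move=> i l; rewrite /set_setup; case: ifP => // /andP[/eqP-> /eqP->].
have openE q t' : open_path (set_setup (y x) r t 0) r q t' = open_path (y x) r q t'.
  by case: q => [[a b] c]; rewrite /open_path !setupE.
(* Every commodity [t' >= t] delivered in [k] can follow [p] instead: both paths
   stay within [t], so their costs differ as they do for commodity [t]. *)
apply: (reroute_optimal (v := 0) opt); [by left | by rewrite yt |].
move=> t' t'T; have [t'E | t't] := eqVneq t' t.
  by exists p; rewrite t'E openE p_open pk yt subrr !mulr0 addr0 p_cost !implybT.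
have := dem_ge0 r t'T; rewrite le_eqVlt => /orP[/eqP<-|d'_gt0].
  by exists (0, 0, 0)%N; rewrite ltxx !mul0r addr0 /= commodity_cost_ge0.
have [q q_open q_cost] := cheap_path feas t'T d'_gt0.
rewrite d'_gt0.
have [/andP[tt' /eqP qk] | q_ok] := boolP ((t <= t')%N && (q.2 == k)).
  exists p; rewrite openE (open_path_tail tt') //= pk implybT andbT mul0r addr0.
  apply: le_trans q_cost; rewrite ler_wpM2l ?(ltW d'_gt0) //.
  rewrite (unit_cost_tail _ _ tt') ?(open_path_le p_open) //.
  rewrite (unit_cost_tail _ (p := q) _ tt') ?qk ?(ltnW hkt) // lerD2r ltW //.
  (* As [k < t], the path [q] also serves commodity [t], so [none] compares it with [p]. *)
  case: q qk q_open => [[a b] c] /= -> q_open; apply: none.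
  by move: q_open => /= /and5P[-> -> -> _ ->]; rewrite (ltnW hkt).
exists q; rewrite openE q_open mul0r addr0 q_cost /=.
by apply/implyP => tt'; move: q_ok; rewrite tt'.
Qed.
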